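(* Let $\mathbb{K}$ be a field and $\Delta$ a simplicial complex on vertex set $[n]$ of dimension $d>0$ such that $f_{d-1}\ge f_d$ and $\tilde H_d(\Delta;\mathbb{K})\neq0$. Let $J=I_\Delta+(x_1^{d+2},\dots,x_n^{d+2})\subset R=\mathbb{K}[x_1,\dots,x_n]$. Then $R/J$ fails the weak Lefschetz property.
   Context: $f_i$ is the number of $i$-dimensional faces of $\Delta$; $I_\Delta=(\prod_{i\in\tau}x_i:\tau\notin\Delta)$ is the Stanley–Reisner ideal. An artinian graded algebra $A$ with top nonzero degree $D$ has the weak Lefschetz property (WLP) if there is a linear form $\ell$ such that multiplication $\times\ell:A_i\to A_{i+1}$ has full rank (injective or surjective) for every $i<D$. *)

(* Defs.v *)
From HB Require Import structures.
From mathcomp Require Import all_boot all_order all_algebra.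
From mathcomp Require Import mpoly.
Set Implicit Arguments. Unset Strict Implicit. Unset Printing Implicit Defensive.
Import Order.TTheory GRing.Theory.
Local Open Scope ring_scope.

Definition is_simplicial_complex (n : nat) (Delta : {set {set 'I_n}}) : Prop :=
  set0 \in Delta /\
  (forall s t : {set 'I_n}, s \in Delta -> t \subset s -> t \in Delta).

Definition has_vertex_set (n : nat) (Delta : {set {set 'I_n}}) : Prop :=
  forall v : 'I_n, [set v] \in Delta.

Definition sc_dim (n : nat) (Delta : {set {set 'I_n}}) (d : nat) : Prop :=
  (exists2 s, s \in Delta & #|s| = d.+1) /\
  (forall s, s \in Delta -> (#|s| <= d.+1)%N).

Definition fvec (n : nat) (Delta : {set {set 'I_n}}) (i : nat) : nat :=
  #|[set s in Delta | #|s| == i.+1]|.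

Definition is_chain (K : fieldType) (n : nat) (Delta : {set {set 'I_n}})
    (k : nat) (c : {ffun {set 'I_n} -> K}) : Prop :=
  forall s, c s != 0 -> s \in Delta /\ #|s| = k.+1.

(* simplicial boundary, vertices ordered by the order of 'I_n:
   d [v_0 < ... < v_k] = sum_j (-1)^j [v_0..^v_j..v_k];
   coefficient of tau in d c = sum over v not in tau of
   (-1)^(position of v in tau + v) * c(tau + v). Including the empty face
   gives the augmented (reduced) chain complex. *)
Definition boundary (K : fieldType) (n : nat) (c : {ffun {set 'I_n} -> K})
  : {ffun {set 'I_n} -> K} :=
  [ffun tau : {set 'I_n} =>
     \sum_(v : 'I_n | v \notin tau)
        (-1) ^+ #|[set u in tau | (u < v)%N]| * c (v |: tau)].

Definition red_homology_nonzero (K : fieldType) (n : nat)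
    (Delta : {set {set 'I_n}}) (k : nat) : Prop :=
  exists z : {ffun {set 'I_n} -> K},
    [/\ is_chain Delta k z, boundary z = 0 &
        ~ (exists b, is_chain Delta k.+1 b /\ boundary b = z)].

Definition is_form (K : fieldType) (n : nat) (i : nat) (p : {mpoly K[n]}) : bool :=
  p \is @ishomog1 n K i mdeg.

Definition in_ideal (K : fieldType) (n : nat) (gen : {mpoly K[n]} -> Prop)
    (p : {mpoly K[n]}) : Prop :=
  exists s : seq ({mpoly K[n]} * {mpoly K[n]}),
    (forall q, q \in s -> gen q.2) /\ p = \sum_(q <- s) q.1 * q.2.

Definition SR_gen (K : fieldType) (n : nat) (Delta : {set {set 'I_n}})
    (p : {mpoly K[n]}) : Prop :=
  exists2 tau : {set 'I_n}, tau \notin Delta & p = \prod_(i in tau) 'X_i.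

Definition J_gen (K : fieldType) (n : nat) (Delta : {set {set 'I_n}}) (e : nat)
    (p : {mpoly K[n]}) : Prop :=
  SR_gen Delta p \/ exists i : 'I_n, p = 'X_i ^+ e.

(* The graded algebra A = R/I for an ideal I given by a membership predicate.
   A_i <> 0 iff some degree-i form is not in I. *)
Definition graded_piece_nonzero (K : fieldType) (n : nat)
    (I : {mpoly K[n]} -> Prop) (i : nat) : Prop :=
  exists2 f, is_form i f & ~ I f.

Definition top_degree (K : fieldType) (n : nat) (I : {mpoly K[n]} -> Prop)
    (D : nat) : Prop :=
  graded_piece_nonzero I D /\ forall j, (D < j)%N -> ~ graded_piece_nonzero I j.

Definition mult_full_rank (K : fieldType) (n : nat) (I : {mpoly K[n]} -> Prop)
    (l : {mpoly K[n]}) (i : nat) : Prop :=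
  (forall f, is_form i f -> I (l * f) -> I f) \/
  (forall g, is_form i.+1 g -> exists2 f, is_form i f & I (g - l * f)).

Definition WLP (K : fieldType) (n : nat) (I : {mpoly K[n]} -> Prop) : Prop :=
  exists2 l : {mpoly K[n]}, is_form 1 l &
    forall D, top_degree I D -> forall i, (i < D)%N -> mult_full_rank I l i.

(* Main.v *)
(** Put N = (d+1)(d+2)/2. For every linear form l, the map l : A_(N-1) -> A_N
    is neither injective nor surjective.

    It is not surjective. Let z be a nonzero d-cycle. The Macaulay dual
    polynomial
      F = sum_(facets s) z_s sum_(pi : s -> [1, d+1] bijective) sgn(pi) x^pi
    has degree N and is annihilated by contraction with x_1 + ... + x_n:
    lowering an exponent k+1 > 1 creates two equal exponents k, so the terms
    cancel in pairs, and lowering the exponent 1 yields the boundary of z.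
    For l = sum a_v x_v with all a_v nonzero, rescale the variables. If
    Z = {v : a_v = 0} is nonempty, take s0 in the support of z meeting Z in as
    many vertices as possible, give the vertices of s0 in Z the largest
    exponents, and keep only the terms of F with these exponents on Z (this is
    the same construction in the link of the intersection of s0 and Z).

    It is not injective because dim A_N <= dim A_(N-1). Indeed
    dim A_j = sum_k f_(k-1) C_k(j), where C_k(j) counts the compositions of j
    into k parts from [1, d+1]; these numbers are symmetric about k(d+2)/2 and
    unimodal, so C_k(N) <= C_k(N-1) for k <= d, and the increase for k = d+1
    equals the decrease for k = d; now use f_d <= f_(d-1). *)
Require Import Defs.
From HB Require Import structures.
From mathcomp Require Import all_boot all_order all_fingroup all_algebra.
From mathcomp Require Import zify.
From mathcomp Require Import mpoly.
Set Implicit Arguments. Unset Strict Implicit. Unset Printing Implicit Defensive.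
Import Order.TTheory GRing.Theory Num.Theory.
Local Open Scope ring_scope.

(** * Compositions with parts in [1, d+1] *)

(* The argument j is an integer so that no subtraction is truncated. *)
Fixpoint ncomp (d k : nat) (j : int) : int :=
  if k is k'.+1 then \sum_(a < d.+1) ncomp d k' (j - (a.+1)%:Z) else (j == 0)%:R.

Lemma ncomp_neg d k j : j < 0 -> ncomp d k j = 0.
Proof.
elim: k j => [|k IH] j j_lt0 /=; first by rewrite lt_eqF.
by apply: big1 => a _; apply: IH; lia.
Qed.

(** Replace every part [p] by [d.+2 - p]. *)
Lemma ncomp_sym d k j : ncomp d k (k%:Z * d.+2%:Z - j) = ncomp d k j.
Proof.
elim: k j => [|k IH] j /=; first by rewrite mul0r sub0r oppr_eq0.
rewrite (reindex_inj rev_ord_inj) /=; apply: eq_bigr => a _.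
rewrite -IH; congr ncomp; have := ltn_ord a; lia.
Qed.

(** Summing over one part adds up [ncomp d k] on a window of [d.+1] consecutive arguments; moving
    the window by one step gains [j] and loses [j - d.+1]. *)
Lemma ncompS_diff d k j :
  ncomp d k.+1 (j + 1) - ncomp d k.+1 j = ncomp d k j - ncomp d k (j - d.+1%:Z).
Proof.
rewrite /= big_ord_recl big_ord_recr /= opprD addrA.
congr (_ - _); rewrite -[RHS]addr0 -addrA; congr (ncomp d k _ + _); first lia.
apply/eqP; rewrite subr_eq0; apply/eqP; apply: eq_bigr => a _.
by congr ncomp; rewrite /= /bump; lia.
Qed.

Lemma ncomp_unimodal d k j :
  k%:Z * d.+2%:Z <= 2 * j + 1 -> ncomp d k (j + 1) <= ncomp d k j.
Proof.
elim: k j => [|k IH] j hj; first by rewrite /= (_ : (j + 1 == 0) = false) ?ler0n //; lia.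
have mono a t : k%:Z * d.+2%:Z <= 2 * a + 1 -> ncomp d k (a + t%:Z) <= ncomp d k a.
  move=> ha; elim: t => [|t IHt]; first by rewrite addr0.
  rewrite -[t.+1]addn1 PoszD addrA; apply: le_trans IHt; apply: IH; lia.
rewrite -subr_le0 ncompS_diff subr_le0.
case: (lerP (k%:Z * d.+2%:Z) (2 * (j - d.+1%:Z))) => h.
  by rewrite -[X in ncomp d k X <= _](subrK d.+1%:Z) mono //; lia.
(* Here [j - d.+1] lies before the midpoint for [k] parts. Its mirror image [b] lies beyond it, and
   the hypothesis on [j] says exactly that [b <= j]. *)
rewrite -[leRHS]ncomp_sym.
set b := k%:Z * d.+2%:Z - _.
have -> : j = b + `|j - b|%N%:Z by rewrite /b; nia.
by apply: mono; rewrite /b; lia.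
Qed.

(** For [d] parts the mirror image of [N] is [d * d.+2 - N = N - 1 - d.+1], the value that leaves
    the window. *)
Lemma ncomp_middle d (N : int) : 2 * N = d.+1%:Z * d.+2%:Z ->
  ncomp d d.+1 N - ncomp d d.+1 (N - 1) = ncomp d d (N - 1) - ncomp d d N.
Proof.
move=> hN; rewrite -{1}[N](subrK 1) ncompS_diff; congr (_ - _).
by rewrite -ncomp_sym; congr ncomp; nia.
Qed.

(** * Counting standard monomials by degree *)

Definition part_poly (d : nat) : {poly int} := \sum_(a < d.+1) 'X^(a.+1).

Lemma ncomp_coef d k j : ncomp d k j%:Z = (part_poly d ^+ k)`_j.
Proof.
elim: k j => [|k IH] j; first by rewrite expr0 coef1.
rewrite exprS {1}/part_poly mulr_suml coef_sum /=; apply: eq_bigr => a _.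
rewrite coefXnM; case: ltnP => h; first by rewrite ncomp_neg //; lia.
by rewrite -IH; congr ncomp; lia.
Qed.

(** Expand a product over all variables in which those in [s] contribute [part_poly d] and the
    others 1. The terms are indexed by exponent vectors, and a vector with another support has a
    zero factor. *)
Lemma card_ncomp n d (s : {set 'I_n}) (j : nat) :
  #|[set e : {ffun 'I_n -> 'I_d.+2} |
      ([set v | e v != ord0] == s) && (\sum_v (e v : nat) == j)%N]|%:R
  = ncomp d #|s| j%:Z.
Proof.
rewrite ncomp_coef.
pose Q (v : 'I_n) (a : 'I_d.+2) : {poly int} :=
  if (v \in s) == (a != ord0) then 'X^a else 0.
have -> : part_poly d ^+ #|s| = \prod_v \sum_a Q v a.
  rewrite -prodr_const [RHS](bigID (mem s)) /= [X in _ * X]big1 ?mulr1.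
    apply: eq_bigr => v vs; rewrite big_ord_recl /Q vs /= add0r.
    by apply: eq_bigr => a _; rewrite /= /bump add1n.
  move=> v /negbTE vs; rewrite big_ord_recl /Q vs /= expr0 big1 ?addr0 //.
rewrite bigA_distr_bigA coef_sum /= -sum1_card natr_sum [LHS]big_mkcond /=.
apply: eq_bigr => e _; rewrite inE /Q.
case: (altP eqP) => [<-|ne] /=.
  rewrite (eq_bigr (fun v => 'X^(e v))) => [|v _]; last by rewrite inE eqxx.
  by rewrite -expr_sum coefXn eq_sym; case: eqP.
suff [v hv] : exists v, (v \in s) != (e v != ord0).
  by rewrite (bigD1 v) //= (negbTE hv) mul0r coef0.
apply/existsP; apply: contraNT ne; rewrite negb_exists => /forallP h.
by apply/eqP/setP => v; rewrite inE; have := h v; rewrite negbK => /eqP.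
Qed.

Definition evars n d (e : {ffun 'I_n -> 'I_d.+2}) : {set 'I_n} :=
  [set v | e v != ord0].

(** For a complex [Delta], these index the monomial basis of the degree-[j] piece of [R/J]; the
    bound [d.+1] on exponents is in the type. *)
Definition expos n d (Delta : {set {set 'I_n}}) (j : nat) :
    {set {ffun 'I_n -> 'I_d.+2}} :=
  [set e | (evars e \in Delta) && (\sum_v (e v : nat) == j)%N].

Lemma card_expos n d (Delta : {set {set 'I_n}}) j :
  #|expos d Delta j|%:R = \sum_(s in Delta) ncomp d #|s| j%:Z.
Proof.
rewrite -sum1_card (partition_big (@evars n d) (mem Delta)) /=; last first.
  by move=> e; rewrite inE => /andP[].
rewrite natr_sum; apply: eq_bigr => s sD; rewrite -card_ncomp -sum1_card.
congr (_%:R); apply: eq_bigl => e; rewrite !inE.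
by case: (_ =P s) => [->|_]; rewrite ?sD ?andbT ?andbF.
Qed.

Lemma leq_card_expos n d (Delta : {set {set 'I_n}}) (N : nat) :
  (0 < d)%N -> (forall s, s \in Delta -> #|s| <= d.+1)%N ->
  (fvec Delta d <= fvec Delta d.-1)%N -> (N.*2 = d.+1 * d.+2)%N ->
  (#|expos d Delta N| <= #|expos d Delta N.-1|)%N.
Proof.
move=> d_gt0 dimD fD hN.
have -> : (#|expos d Delta N| <= #|expos d Delta N.-1|)%N =
  (#|expos d Delta N|%:R <= #|expos d Delta N.-1|%:R :> int) by rewrite ler_nat.
rewrite !card_expos -subr_le0 -sumrB.
have -> : N.-1%:Z = N%:Z - 1 by nia.
pose D k := ncomp d k N%:Z - ncomp d k (N%:Z - 1).
have D_le0 k : (k <= d)%N -> D k <= 0.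
  move=> kd; rewrite /D subr_le0 -{1}[N%:Z](subrK 1) ncomp_unimodal //; nia.
have D_top : D d.+1 = - D d by rewrite /D ncomp_middle ?opprB //; nia.
(* Faces with fewer than [d] vertices contribute at most 0. The other two sizes give
   [(f_d - f_(d-1)) * D d.+1], where [D d.+1 >= 0]. Positivity of [d] makes [d.-1] the true index of
   the faces with [d] vertices. *)
rewrite (bigID (fun s : {set 'I_n} => #|s| == d.+1)) /=.
rewrite [X in _ + X](bigID (fun s : {set 'I_n} => #|s| == d)) /= addrA.
have sumD k (P : pred {set 'I_n}) :
    (forall s, P s = (s \in Delta) && (#|s| == k.+1)) ->
    \sum_(s | P s) D #|s| = (fvec Delta k)%:R * D k.+1.
  move=> hP; rewrite (eq_bigr (fun=> D k.+1)); last first.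
    by move=> s; rewrite hP => /andP[_ /eqP->].
  rewrite sumr_const mulr_natl; congr (_ *+ _); apply: eq_card => s.
  by rewrite !inE -hP.
rewrite (sumD d) // (sumD d.-1) ?prednK //; last first.
  by move=> s; rewrite -andbA; case: (#|s| =P d) => [->|_]; rewrite ?andbF // ltn_eqF.
have := D_le0 d (leqnn d); rewrite D_top => Dd.
set S := \sum_(_ | _) _; have S_le0 : S <= 0.
  apply: sumr_le0 => s /andP[/andP[sD n1] n2]; apply: D_le0.
  by have := dimD s sD; rewrite leq_eqVlt (negbTE n1) ltnS.
nia.
Qed.

(** * Full monomials and their signs *)

Definition mvars n (m : 'X_{1..n}) : {set 'I_n} := [set v | m v != 0%N].

(* The nonzero exponents of m are 1, ..., d+1, each occurring exactly once. *)
Definition is_full n d (m : 'X_{1..n}) : bool :=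
  [forall v, m v <= d.+1]%N && [forall k : 'I_d.+1, #|[set v | m v == k.+1]| == 1]%N.

Lemma full_le n d (m : 'X_{1..n}) v : is_full d m -> (m v <= d.+1)%N.
Proof. by case/andP => /forallP. Qed.

Lemma full_card n d (m : 'X_{1..n}) k : is_full d m -> (0 < k <= d.+1)%N ->
  #|[set v | m v == k]| = 1%N.
Proof. by case/andP => _ /forallP h; case: k => // k hk; apply/eqP/(h (Ordinal hk)). Qed.

Lemma full_onto n d (m : 'X_{1..n}) k : is_full d m -> (0 < k <= d.+1)%N ->
  exists v, m v = k.
Proof.
move=> fm hk; have /eqP/cards1P[v /setP hv] := full_card fm hk.
by exists v; have := hv v; rewrite !inE eqxx => /eqP.
Qed.

Lemma full_inj n d (m : 'X_{1..n}) u v : is_full d m -> (0 < m u)%N -> m u = m v -> u = v.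
Proof.
move=> fm u0 uv; have hk : (0 < m u <= d.+1)%N by rewrite u0 (full_le u fm).
have /eqP/cards1P[w /setP hw] := full_card fm hk.
have := hw u; have := hw v; rewrite !inE -uv eqxx => /esym/eqP-> /esym/eqP->.
by [].
Qed.

Lemma full_mdeg n d (m : 'X_{1..n}) : is_full d m -> ((mdeg m).*2 = d.+1 * d.+2)%N.
Proof.
move=> fm; have -> : mdeg m = (\sum_(k < d.+2) (k : nat))%N.
  rewrite mdegE (partition_big (fun v => inord (m v) : 'I_d.+2) predT) //=.
  apply: eq_bigr => k _.
  rewrite (eq_big (fun v => m v == k) (fun=> (k : nat))); first last.
  - by move=> v /eqP <-; rewrite inordK // ltnS (full_le v fm).
  - by move=> v; rewrite -val_eqE /= inordK // ltnS (full_le v fm).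
  rewrite sum_nat_const; case: (posnP k) => [->|k0]; first by rewrite muln0.
  rewrite -[RHS]mul1n -(@full_card _ _ _ k fm) ?k0 -1?ltnS ?ltn_ord //.
  by congr (_ * _)%N; apply: eq_card => v; rewrite inE.
have sum_ord e : ((\sum_(k < e.+1) (k : nat)).*2 = e * e.+1)%N.
  elim: e => [|e IH]; first by rewrite big_ord1.
  by rewrite big_ord_recr doubleD IH /=; nia.
exact: sum_ord.
Qed.

Lemma mnm_swap n (m : 'X_{1..n}) v w u :
  m v = m w -> (m + U_(w))%MM u = (m + U_(v))%MM (tperm v w u).
Proof.
move=> vw; rewrite !mnmDE !mnm1E.
case: tpermP => [->|->|/eqP uv /eqP uw]; rewrite ?eqxx ?vw //.
- by rewrite eq_sym.
- by rewrite ![_ == u]eq_sym (negbTE uv) (negbTE uw).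
Qed.

Lemma full_swap n d (m : 'X_{1..n}) v w :
  m v = m w -> is_full d (m + U_(v))%MM = is_full d (m + U_(w))%MM.
Proof.
suff imp v' w' : m v' = m w' -> is_full d (m + U_(v'))%MM -> is_full d (m + U_(w'))%MM.
  by move=> vw; apply/idP/idP; apply: imp.
move=> vw fm; apply/andP; split; apply/forallP.
  by move=> u; rewrite (mnm_swap _ vw) (full_le _ fm).
move=> k; have hk : (0 < k.+1 <= d.+1)%N by rewrite ltnS ltn_ord.
have := full_card fm hk; rewrite -(card_imset _ (@perm_inj _ (tperm v' w'))) => <-.
apply/eqP/eq_card => u; apply/idP/imsetP => [|[x + ->]]; rewrite !inE (mnm_swap _ vw).
  by move=> h; exists (tperm v' w' u); rewrite ?inE ?tpermK.
by rewrite tpermK.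
Qed.

(** The inversions of a full monomial read as a bijection from its support to [1, d+1]; variables of
    exponent 0 are left out. *)
Definition invset n (m : 'X_{1..n}) : {set 'I_n * 'I_n} :=
  [set p : 'I_n * 'I_n | (p.1 < p.2)%N && (0 < m p.2 < m p.1)%N].

Definition msign (K : fieldType) n (m : 'X_{1..n}) : K := (-1) ^+ #|invset m|.

(** No variable other than [v] and [w] has exponent [m v] or [(m v).+1], so comparisons with the
    others agree on both sides, and only the pair of [v] and [w] changes its inversion status. *)
Lemma msign_swap (K : fieldType) n (m : 'X_{1..n}) v w :
  v != w -> (0 < m v)%N -> m v = m w ->
  (forall u, m u = m v -> u = v \/ u = w) -> (forall u, m u != (m v).+1) ->
  msign K (m + U_(w))%MM = - msign K (m + U_(v))%MM.
Proof.
move=> nvw v0 vw hk hk1.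
wlog ltvw : v w nvw v0 vw hk hk1 / (v < w)%N => [hw|].
  case: (ltngtP v w) => h; first exact: hw.
    rewrite (hw w v) ?opprK ?(eq_sym w) -?vw //.
      by move=> u /hk[]; tauto.
  by move: nvw; rewrite (val_inj h) eqxx.
rewrite /msign; suff -> : invset (m + U_(v))%MM = (v, w) |: invset (m + U_(w))%MM.
  rewrite cardsU1 exprD.
  have -> : (v, w) \notin invset (m + U_(w))%MM; last by rewrite expr1 mulN1r opprK.
  by rewrite inE /= !mnmDE !mnm1E eqxx eq_sym (negbTE nvw); lia.
apply/setP => -[a b]; rewrite !inE /= xpair_eqE !mnmDE !mnm1E ![_ == v]eq_sym ![_ == w]eq_sym.
have ha := hk a; have hb := hk b; have ha1 := hk1 a; have hb1 := hk1 b.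
have nwv : (w == v) = false by rewrite eq_sym (negbTE nvw).
case: (eqVneq v a) => [va|nva]; last case: (eqVneq w a) => [wa|nwa].
- subst a; rewrite nwv; case: (eqVneq v b) => [vb|nvb]; first by subst b; lia.
  case: (eqVneq w b) => [wb|nwb]; first by subst b; lia.
  have : m b <> m v by move=> /hb[] E; [move: nvb|move: nwb]; rewrite E eqxx.
  lia.
- subst a; case: (eqVneq v b) => [vb|nvb]; first by subst b; lia.
  case: (eqVneq w b) => [wb|nwb]; first by subst b; lia.
  have : m b <> m v by move=> /hb[] E; [move: nvb|move: nwb]; rewrite E eqxx.
  lia.
- have : m a <> m v by move=> /ha[] E; [move: nva|move: nwa]; rewrite E eqxx.
  case: (eqVneq v b) => [vb|nvb]; first by subst b; rewrite nwv; lia.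
  by case: (eqVneq w b) => [wb|nwb]; first subst b; lia.
Qed.

(** The new exponent 1 is the smallest nonzero one, so the added inversions pair [v] with the
    support variables before it. This is the sign in [boundary]. *)
Lemma msign_add1 (K : fieldType) n (m : 'X_{1..n}) v :
  m v = 0%N -> (forall u, m u != 1%N) ->
  msign K (m + U_(v))%MM = msign K m * (-1) ^+ #|[set u in mvars m | (u < v)%N]|.
Proof.
move=> v0 m1; rewrite /msign -exprD; congr (_ ^+ _).
pose A := [set (u, v) | u in [set u in mvars m | (u < v)%N]].
have -> : invset (m + U_(v))%MM = invset m :|: A.
  apply/setP => -[a b]; rewrite !inE /= !mnmDE !mnm1E.
  have -> : ((a, b) \in A) = [&& b == v, m a != 0%N & (a < v)%N].
    apply/imsetP/idP => [[u]|/and3P[/eqP-> a0 av]].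
      by rewrite !inE => h [-> ->]; rewrite eqxx.
    by exists a => //; rewrite !inE a0.
  have := m1 a; have := m1 b.
  case: (eqVneq v a) => [va|nva]; first by subst a; case: eqVneq => [|]; lia.
  case: (eqVneq v b) => [vb|nvb]; first by subst b; rewrite ?eqxx; lia.
  by lia.
rewrite cardsU (_ : _ :&: _ = set0) ?cards0 ?subn0.
  by rewrite card_imset // => x y [].
apply/setP => -[a b]; rewrite !inE /=; apply/negP => /andP[h /imsetP[u _ [_ bv]]].
by move: h; rewrite bv v0 andbF.
Qed.

(** * The dual polynomial and its contraction *)

Section Dual.
Variables (K : fieldType) (n d : nat) (Z : {set 'I_n}) (z : {ffun {set 'I_n} -> K}).
Variable m0 : 'X_{1..n}.

(* The coefficients of the dual polynomial F before rescaling; m0 fixes the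
   exponents on Z. *)
Definition dualF (m : 'X_{1..n}) : K :=
  if is_full d m && [forall v in Z, m v == m0 v] then msign K m * z (mvars m) else 0.

Hypothesis z_cycle : boundary z = 0.
Hypothesis max_m0 : forall s, z s != 0 -> (#|s :&: Z| <= #|mvars m0 :&: Z|)%N.
Hypothesis top_m0 : forall w k, w \in Z -> (0 < m0 w < k)%N -> (k <= d.+1)%N ->
  exists2 w', w' \in Z & m0 w' = k.

Lemma agree_add (m : 'X_{1..n}) v : v \notin Z ->
  [forall w in Z, (m + U_(v))%MM w == m0 w] = [forall w in Z, m w == m0 w].
Proof.
move=> vZ; apply: eq_forallb => w; case wZ: (w \in Z) => //=.
rewrite mnmDE mnm1E; case: (eqVneq v w) => [vw|_]; last by rewrite addn0.
by move: vZ; rewrite vw wZ.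
Qed.

Lemma mvars_add (m : 'X_{1..n}) v : mvars (m + U_(v))%MM = v |: mvars m.
Proof.
apply/setP => w; rewrite !inE mnmDE mnm1E (eq_sym v) addn_eq0 negb_and orbC.
by case: (w == v).
Qed.

(** Since [m v = m w] is positive, both monomials have the same support and see the same coefficient
    of [z]; only the sign differs. *)
Lemma dualF_swap (m : 'X_{1..n}) v w : v \notin Z -> w \notin Z -> v != w ->
  (0 < m v)%N -> m v = m w -> is_full d (m + U_(v))%MM ->
  dualF (m + U_(w))%MM = - dualF (m + U_(v))%MM.
Proof.
move=> vZ wZ nvw v0 vw fv; rewrite /dualF -(full_swap d vw) !agree_add // !mvars_add fv.
have nwv : w != v by rewrite eq_sym.
case: ifP => _; last by rewrite oppr0.
have -> : v |: mvars m = w |: mvars m.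
  apply/setP => u; rewrite !inE; case: (eqVneq u v) => [->|_]; first by rewrite -lt0n v0 !orbT.
  by case: (eqVneq u w) => [->|_] //=; rewrite -vw -lt0n v0.
rewrite (msign_swap K nvw) ?mulNr // => u.
  move=> um; case: (eqVneq u v) => [->|nuv]; [by left|right].
  apply/esym/(full_inj fv); rewrite !mnmDE !mnm1E (negbTE nvw) eq_sym in nuv *.
    by rewrite -vw addn0.
  by rewrite (negbTE nuv) um vw !addn0.
apply/negP => /eqP um; move/eqP: nvw.
have nuv : v != u by apply/eqP => E; move: um; rewrite -E; lia.
have : v = u by apply: (full_inj fv); rewrite !mnmDE !mnm1E eqxx ?(negbTE nuv) ?um; lia.
by move=> E; rewrite E eqxx in nuv.
Qed.

(** Up to rescaling, this is contraction with a linear form whose coefficients vanish exactly on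
    [Z]. *)
Lemma dualF_contract (m : 'X_{1..n}) : \sum_(v | v \notin Z) dualF (m + U_(v))%MM = 0.
Proof.
have [[v0 v0Z Fv0]|h] : (exists2 v, v \notin Z & dualF (m + U_(v))%MM != 0) \/
    forall v, v \notin Z -> dualF (m + U_(v))%MM = 0.
- case: (boolP [exists v, (v \notin Z) && (dualF (m + U_(v))%MM != 0)]).
    by case/existsP=> v /andP[vZ Fv]; left; exists v.
  rewrite negb_exists => /forallP h; right => v vZ.
  by have := h v; rewrite vZ /= negbK => /eqP.
- have fv0 : is_full d (m + U_(v0))%MM by move: Fv0; rewrite /dualF; case: is_full; rewrite ?eqxx.
  have ag : [forall w in Z, m w == m0 w].
    by apply: contraNT Fv0 => /negbTE ag; rewrite /dualF agree_add // ag andbF.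
  have le0 := full_le v0 fv0; rewrite mnmDE mnm1E eqxx in le0.
  case: (posnP (m v0)) => [m_v0|m_v0].
  (* Only exponent-0 variables can be raised, which gives the boundary of z. *)
  + have m1 u : m u != 1%N.
      apply/eqP => mu; have nvu : v0 != u by apply/eqP => E; rewrite -E m_v0 in mu.
      move/eqP: (nvu); apply.
      by apply: (full_inj fv0); rewrite !mnmDE !mnm1E eqxx ?(negbTE nvu) ?m_v0 ?mu.
    have Fv v : v \notin Z -> dualF (m + U_(v))%MM = msign K m *
        (if v \notin mvars m then (-1) ^+ #|[set u in mvars m | (u < v)%N]| * z (v |: mvars m) else 0).
      move=> vZ; rewrite /dualF agree_add // ag andbT mvars_add inE negbK.
      case: eqP => [mv|mv].
        by rewrite -(full_swap d (v := v0)) ?m_v0 ?mv // fv0 msign_add1 // mulrA.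
      (* If [m v] is positive, then [m + U_(v)] has no exponent 1: [m] has none, and raising [v]
         gives at least 2. *)
      rewrite mulr0; case: ifP => // fv.
      have [u] := @full_onto _ _ _ 1 fv isT.
      rewrite mnmDE mnm1E; have := m1 u; case: (eqVneq v u) => [<-|_] mu E; exfalso; first by lia.
      by move/eqP: mu; lia.
    rewrite (eq_bigr _ Fv) -mulr_sumr -big_mkcondr /=.
    have /ffunP/(_ (mvars m)) := z_cycle; rewrite !ffunE => E.
    rewrite -[RHS](mulr0 (msign K m)) -[in RHS]E; congr (_ * _).
    (* The boundary also has terms with [v] in [Z]. There [v |: mvars m] meets [Z] in one vertex
       more than [mvars m0] does, so [z] vanishes on it by [max_m0]. *)
    rewrite [RHS](bigID (mem Z)) /= [X in _ = X + _]big1 ?add0r.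
      by apply: eq_bigl => v; rewrite andbC.
    move=> v /andP[vm vZ]; case: (eqVneq (z (v |: mvars m)) 0) => [->|/max_m0]; first by rewrite mulr0.
    suff -> : (v |: mvars m) :&: Z = v |: (mvars m0 :&: Z).
      rewrite cardsU1 !inE negb_and negbK.
      have -> : m0 v == 0%N; last by lia.
      by have /forallP/(_ v) := ag; rewrite vZ /= => /eqP <-; move: vm; rewrite inE negbK.
    apply/setP => u; rewrite !inE; case: (eqVneq u v) => [->|_] /=; first by rewrite vZ.
    by have /forallP/(_ u) := ag; case: (u \in Z); rewrite ?andbF //= => /eqP ->.
  (* Exactly two variables, v0 and w, have exponent m v0; their terms cancel. *)
  + have [w] := @full_onto _ _ _ (m v0) fv0 (ltac:(lia)).
    rewrite mnmDE mnm1E; case: (eqVneq v0 w) => [<-|nvw]; first by lia.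
    rewrite addn0 => mw.
    (* Otherwise [top_m0] puts the exponent [(m v0).+1] on a vertex of [Z], and raising [v0] outside
       [Z] would produce it a second time. *)
    have wZ : w \notin Z.
      apply/negP => wZ; have /forallP/(_ w) := ag; rewrite wZ mw /= => /eqP m0w.
      have [||w' w'Z m0w'] := @top_m0 w (m v0).+1 wZ; try lia.
      have /forallP/(_ w') := ag; rewrite w'Z m0w' /= => /eqP mw'.
      have nw' : v0 != w' by apply/eqP => E; rewrite E w'Z in v0Z.
      move/eqP: (nw'); apply; apply: (full_inj fv0); rewrite !mnmDE !mnm1E ?eqxx ?(negbTE nw') ?mw'; lia.
    rewrite (bigD1 v0) //= (bigD1 w) /=; last by rewrite wZ eq_sym.
    rewrite (dualF_swap v0Z wZ) // addrA subrr add0r big1 // => v /andP[/andP[vZ nv] nw].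
    (* Raising a third variable leaves [v0] and [w] with equal positive exponents. *)
    rewrite /dualF; case: ifP => // /andP[fv _]; move/eqP: nvw; case.
    by apply: (full_inj fv); rewrite !mnmDE !mnm1E (negbTE nv) ?(negbTE nw) ?addn0.
- by rewrite big1.
Qed.

End Dual.

(** Number the vertices of [S] outside [Z] first and those in [Z] last; the exponent is the position
    counted from 1. *)
Lemma exists_full n d (S Z : {set 'I_n}) : #|S| = d.+1 ->
  exists m : 'X_{1..n}, [/\ is_full d m, mvars m = S &
    forall w k, w \in Z -> (0 < m w < k)%N -> (k <= d.+1)%N ->
      exists2 w', w' \in Z & m w' = k].
Proof.
move=> cS; pose s := enum (S :\: Z) ++ enum (S :&: Z).
have mem_s v : (v \in s) = (v \in S).
  by rewrite mem_cat !mem_enum !inE; case: (v \in S); case: (v \in Z).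
have s_uniq : uniq s.
  rewrite cat_uniq !enum_uniq andbT /=; apply/hasPn => v.
  by rewrite !mem_enum !inE => /andP[_ ->].
have s_size : size s = d.+1 by rewrite size_cat -!cardE addnC cardsID.
have x0 : 'I_n by case: s s_size {mem_s s_uniq}.
pose m := [multinom (if v \in s then (index v s).+1 else 0%N) | v < n].
have m_nth k : (k < d.+1)%N -> m (nth x0 s k) = k.+1.
  by move=> hk; rewrite mnmE mem_nth ?s_size // index_uniq ?s_size.
have m_inv v : m v != 0%N -> (m v <= d.+1)%N /\ v = nth x0 s (m v).-1.
  by rewrite mnmE; case: ifP => // vs _; rewrite /= nth_index // -s_size index_mem.
exists m; split.
- apply/andP; split; apply/forallP; [move=> v|move=> k].
    by case: (eqVneq (m v) 0%N) => [->|/m_inv[]].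
  apply/cards1P; exists (nth x0 s k); apply/setP => v; rewrite !inE.
  apply/eqP/eqP => [mv|->]; last exact: m_nth.
  by have [_ ->] := m_inv v (ltac:(by rewrite mv)); rewrite mv.
- by apply/setP => v; rewrite inE mnmE mem_s; case: (v \in S).
- move=> w k wZ /andP[w0 wk] kd; exists (nth x0 s k.-1); last by rewrite m_nth; lia.
  have sz1 : (size (enum (S :\: Z)) <= (m w).-1)%N.
    have [_ ew] := m_inv w (ltac:(by rewrite -lt0n)).
    case: leqP => // lt; have : w \in enum (S :\: Z) by rewrite ew nth_cat lt mem_nth.
    by rewrite mem_enum inE wZ.
  have sz2 : (size (enum (S :\: Z)) <= k.-1)%N by apply: leq_trans sz1 _; lia.
  rewrite nth_cat ltnNge sz2 /=.
  have : nth x0 (enum (S :&: Z)) (k.-1 - size (enum (S :\: Z))) \in enum (S :&: Z).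
    by apply: mem_nth; rewrite ltn_subLR // -size_cat s_size; lia.
  by rewrite mem_enum inE => /andP[].
Qed.

Lemma exists_dual (K : fieldType) n d (Delta : {set {set 'I_n}}) (a : 'I_n -> K)
    (z : {ffun {set 'I_n} -> K}) s0 :
  is_chain Delta d z -> boundary z = 0 -> z s0 != 0 ->
  exists F : 'X_{1..n} -> K,
    [/\ forall m, F m != 0 -> is_full d m /\ mvars m \in Delta,
        forall m, \sum_v a v * F (m + U_(v))%MM = 0 & exists m, F m != 0].
Proof.
move=> z_chain z_cycle zs0; pose Z := [set v | a v == 0].
case: (@arg_maxnP _ s0 (fun s => z s != 0) (fun s => #|s :&: Z|) zs0) => S zS maxS.
have [_ cS] := z_chain S zS.
have [m0 [full0 vars0 top0]] := exists_full Z cS.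
(* Any nonzero value does on Z, where (a v)^-1 is 0. *)
pose b v := if v \in Z then 1 else (a v)^-1.
(* The weight rescales the variables: raising [v] multiplies it by [b v], which cancels [a v]
   outside [Z]. *)
pose w (m : 'X_{1..n}) := \prod_v b v ^+ m v.
have b_neq0 v : b v != 0.
  by rewrite /b inE; case: ifP => [_|/negbT]; rewrite ?oner_eq0 ?invr_eq0.
have w_neq0 m : w m != 0 by apply/prodf_neq0 => v _; rewrite expf_neq0.
have wU m v : w (m + U_(v))%MM = w m * b v.
  rewrite /w (eq_bigr (fun u => b u ^+ m u * b u ^+ (v == u))).
    rewrite big_split /=; congr (_ * _); rewrite (bigD1 v) //= eqxx big1 ?mulr1 //.
    by move=> u; rewrite eq_sym => /negbTE->.
  by move=> u _; rewrite mnmDE mnm1E exprD.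
exists (fun m => w m * dualF d Z z m0 m); split.
- move=> m; rewrite mulf_eq0 negb_or => /andP[_]; rewrite /dualF.
  case: ifP => [/andP[fm _]|_]; last by rewrite eqxx.
  by rewrite mulf_eq0 negb_or => /andP[_ /z_chain[]].
- move=> m; have := @dualF_contract K n d Z z m0 z_cycle _ top0 m; rewrite vars0 => /(_ maxS) sum0.
  rewrite -[RHS](mulr0 (w m)) -[in RHS]sum0 mulr_sumr [LHS](bigID (fun v => v \in Z)) /= big1 ?add0r.
    apply: eq_bigr => v vZ; rewrite wU mulrA; congr (_ * _).
    by rewrite /b (negbTE vZ) mulrCA divff ?mulr1 //; move: vZ; rewrite inE.
  by move=> v; rewrite inE => /eqP->; rewrite mul0r.
- exists m0; rewrite mulf_neq0 // /dualF full0 vars0.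
  have -> : [forall u in Z, m0 u == m0 u] by apply/forall_inP => u _.
  by rewrite mulf_neq0 // /msign signr_eq0.
Qed.

(** * The monomial ideal [J] and the top degree of [R/J] *)

Definition standard n e (Delta : {set {set 'I_n}}) (m : 'X_{1..n}) : bool :=
  [forall v, m v < e]%N && (mvars m \in Delta).

Section Ideal.
Variables (K : fieldType) (n e : nat) (Delta : {set {set 'I_n}}).
Hypothesis complexD : is_simplicial_complex Delta.

Local Notation J := (in_ideal (@J_gen K n Delta e)).

Lemma in_ideal0 gen : in_ideal gen (0 : {mpoly K[n]}).
Proof. by exists [::]; split=> [q|]; rewrite ?big_nil. Qed.

Lemma in_idealD gen (p q : {mpoly K[n]}) : in_ideal gen p -> in_ideal gen q -> in_ideal gen (p + q).
Proof.
move=> [s [hs ->]] [t [ht ->]]; exists (s ++ t); split; last by rewrite big_cat.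
by move=> x; rewrite mem_cat => /orP[/hs|/ht].
Qed.

Lemma in_ideal_gen gen (p q : {mpoly K[n]}) : gen q -> in_ideal gen (p * q).
Proof. by move=> hq; exists [:: (p, q)]; split=> [x|]; rewrite ?big_seq1 // inE => /eqP->. Qed.

Lemma prod_varsE (tau : {set 'I_n}) :
  \prod_(i in tau) 'X_i = 'X_[\sum_(i in tau) U_(i)] :> {mpoly K[n]}.
Proof. by rewrite mprodXE. Qed.

Lemma sum_vars_le (tau : {set 'I_n}) (m : 'X_{1..n}) :
  (\sum_(i in tau) U_(i) <= m)%MM = (tau \subset mvars m).
Proof.
have sumE v : (\sum_(i in tau) U_(i))%MM v = (v \in tau).
  rewrite mnm_sumE; case: (boolP (v \in tau)) => vt.
    rewrite (bigD1 v) //= mnm1E eqxx big1 // => u /andP[_ uv].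
    by rewrite mnm1E (negbTE uv).
  by rewrite big1 // => u ut; rewrite mnm1E; case: eqP vt => // <-; rewrite ut.
apply/mnm_lepP/subsetP => [h v vt|h v].
  by have := h v; rewrite sumE vt inE lt0n.
by rewrite sumE; case vt: (v \in tau) => //; have := h v vt; rewrite inE lt0n.
Qed.

Lemma J_genP p : J_gen Delta e p <-> exists2 g : 'X_{1..n}, p = 'X_[K, g] &
  (exists2 tau, tau \notin Delta & g = (\sum_(i in tau) U_(i))%MM) \/
  exists i, g = (U_(i) *+ e)%MM.
Proof.
split=> [[[tau nt ->]|[i ->]]|[g -> [[tau nt ->]|[i ->]]]].
- by exists (\sum_(i in tau) U_(i))%MM; [exact: prod_varsE | left; exists tau].
- by exists (U_(i) *+ e)%MM; [exact: mpolyXn | right; exists i].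
- by left; exists tau => //; rewrite prod_varsE.
- by right; exists i; rewrite mpolyXn.
Qed.

(** The generators are monomials, and none of them divides a standard monomial. *)
Lemma in_ideal_mcoeff p m : J p -> standard e Delta m -> p@_m = 0.
Proof.
move=> [s [hs ->]] /andP[/forallP m_lt mD]; rewrite raddf_sum big1_seq //= => q /hs.
case/J_genP => g -> hg; rewrite mcoeffM big1 // => k /eqP mk.
rewrite mcoeffX; case: eqP => [gk|_]; last by rewrite mulr0.
have gm : (g <= m)%MM by rewrite mk gk lem_addl.
case: hg => [[tau ntau gE]|[i gE]].
  case/negP: ntau; apply: complexD.2 mD _; by rewrite -sum_vars_le -gE.
by have /mnm_lepP/(_ i) := gm; rewrite gE mulmnE mnm1E eqxx mul1n leqNgt m_lt.
Qed.

Lemma in_ideal_nonstandard m c : ~~ standard e Delta m -> J (c *: 'X_[m]).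
Proof.
move=> nstd; suff [g [Jg gm]] : exists g : 'X_{1..n}, J_gen Delta e 'X_[K, g] /\ (g <= m)%MM.
  by rewrite -(submK gm) mpolyXD scalerAl; apply: in_ideal_gen.
move: nstd; rewrite negb_and negb_forall => /orP[/existsP[v mv]|nD].
  exists (U_(v) *+ e)%MM; split; first by apply/J_genP; eexists; [reflexivity | right; exists v].
  apply/mnm_lepP => u; rewrite mulmnE mnm1E; case: eqP => [<-|_] //.
  by rewrite mul1n leqNgt.
exists (\sum_(i in mvars m) U_(i))%MM; split; last by rewrite sum_vars_le.
by apply/J_genP; eexists; [reflexivity | left; exists (mvars m)].
Qed.

Lemma in_idealP p : J p <-> forall m, standard e Delta m -> p@_m = 0.
Proof.
split=> [Jp m|h]; first exact: in_ideal_mcoeff.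
rewrite [p]mpolyE; elim/big_rec: _ => [|m q _ Jq]; first exact: in_ideal0.
apply: in_idealD Jq; case: (boolP (standard e Delta m)) => [/h->|/in_ideal_nonstandard//].
by rewrite scale0r; apply: in_ideal0.
Qed.

End Ideal.

Lemma standard_mdeg n e (Delta : {set {set 'I_n}}) m :
  standard e.+1 Delta m -> (mdeg m <= #|mvars m| * e)%N.
Proof.
case/andP=> /forallP m_le _; rewrite mdegE (bigID (mem (mvars m))) /=.
rewrite [X in (_ + X)%N]big1 ?addn0 => [|v]; last by rewrite inE negbK => /eqP.
by rewrite -sum_nat_const; apply: leq_sum => v _; rewrite -ltnS.
Qed.

(** The degree is attained on a face with [d.+1] vertices, all of exponent [d.+1]. *)
Lemma top_degree_J (K : fieldType) n d (Delta : {set {set 'I_n}}) :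
  is_simplicial_complex Delta -> sc_dim Delta d ->
  top_degree (in_ideal (@J_gen K n Delta d.+2)) (d.+1 * d.+1).
Proof.
move=> cD [[S SD cS] dimD]; split.
  pose m := [multinom (if v \in S then d.+1 else 0%N) | v < n].
  have m_std : standard d.+2 Delta m.
    apply/andP; split; first by apply/forallP => v; rewrite mnmE; case: ifP.
    rewrite (_ : mvars m = S) //; apply/setP => v; rewrite inE mnmE.
    by case: (v \in S).
  exists 'X_[m].
    rewrite /is_form dhomogX /= mdegE (eq_bigr _ (fun v _ => mnmE _ v)) -big_mkcond /=.
    by rewrite sum_nat_const cS.
  move=> /(in_idealP d.+2 cD)/(_ _ m_std); rewrite mcoeffX eqxx.
  by apply/eqP; rewrite oner_eq0.
move=> j jD [f fj]; case; apply/(in_idealP d.+2 cD) => m m_std.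
apply: (dhomog_nemf_coeff fj); apply: contraTneq jD => <-; rewrite -leqNgt.
apply: leq_trans (standard_mdeg m_std) _; rewrite leq_mul2r dimD ?orbT //.
by case/andP: m_std.
Qed.

Lemma form1_mulX (K : fieldType) n (l : {mpoly K[n]}) m : is_form 1 l ->
  l * 'X_[m] = \sum_v l@_U_(v) *: 'X_[m + U_(v)].
Proof.
move=> hl; have {1}-> : l = \sum_v l@_U_(v) *: 'X_v.
  apply/mpolyP => k; rewrite raddf_sum /=.
  case: (boolP (mdeg k == 1%N)) => [/mdeg1P[i /eqP->]|nk].
    rewrite (bigD1 i) //= mcoeffZ mcoeffXU eqxx mulr1 big1 ?addr0 // => v nvi.
    by rewrite mcoeffZ mcoeffXU (negbTE nvi) mulr0.
  rewrite (dhomog_nemf_coeff hl nk) big1 // => v _; rewrite mcoeffZ mcoeffX.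
  by case: (_ =P k) nk => [<-|_ _]; rewrite ?mdeg1 ?mulr0.
by rewrite mulr_suml; apply: eq_bigr => v _; rewrite -scalerAl mpolyXD mulrC.
Qed.

(** * Exponent vectors from a finite type, for sums and matrices *)

Definition mon n d (e : {ffun 'I_n -> 'I_d.+2}) : 'X_{1..n} :=
  [multinom (e v : nat) | v < n].

Lemma mon_inj n d : injective (@mon n d).
Proof.
move=> e e' /mnmP h; apply/ffunP => v; apply/val_inj.
by have := h v; rewrite !mnmE.
Qed.

Lemma monP n d (m : 'X_{1..n}) : (forall v, m v <= d.+1)%N -> exists e, m = mon (d := d) e.
Proof.
by move=> hm; exists [ffun v => inord (m v)]; apply/mnmP => v; rewrite mnmE ffunE inordK // ltnS.
Qed.

Lemma mvars_mon n d (e : {ffun 'I_n -> 'I_d.+2}) : mvars (mon e) = evars e.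
Proof. by apply/setP => v; rewrite !inE mnmE. Qed.

Lemma mdeg_mon n d (e : {ffun 'I_n -> 'I_d.+2}) : mdeg (mon e) = (\sum_v (e v : nat))%N.
Proof. by rewrite mdegE; apply: eq_bigr => v _; rewrite mnmE. Qed.

Lemma standard_mon n d (Delta : {set {set 'I_n}}) (e : {ffun 'I_n -> 'I_d.+2}) :
  standard d.+2 Delta (mon e) = (evars e \in Delta).
Proof. by rewrite /standard mvars_mon andb_idl // => _; apply/forallP => v; rewrite mnmE. Qed.

(** * The functional defined by the dual polynomial *)

Section Functional.
Variables (K : fieldType) (n d : nat) (Delta : {set {set 'I_n}}) (l : {mpoly K[n]}).
Variable F : 'X_{1..n} -> K.
Hypothesis complexD : is_simplicial_complex Delta.
Hypothesis l_form : is_form 1 l.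
Hypothesis F_supp : forall m, F m != 0 -> is_full d m /\ mvars m \in Delta.
Hypothesis F_contract : forall m, \sum_v l@_U_(v) * F (m + U_(v))%MM = 0.

Local Notation J := (in_ideal (@J_gen K n Delta d.+2)).

(** The linear functional taking each ['X_[m]] to [F m]. A finite sum suffices because [F] is
    supported on exponents at most [d.+1]. *)
Definition pairing (p : {mpoly K[n]}) : K :=
  \sum_(e : {ffun 'I_n -> 'I_d.+2}) F (mon e) * p@_(mon e).

Lemma pairingX m : pairing 'X_[m] = F m.
Proof.
have [[e ->]|nm] : (exists e, m = mon (d := d) e) \/ F m = 0.
- case: (eqVneq (F m) 0) => [|/F_supp[fm _]]; [by right|left].
  by apply: monP => v; apply: full_le fm.
- rewrite /pairing (bigD1 e) //= mcoeffX eqxx mulr1 big1 ?addr0 // => e' ne.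
  by rewrite mcoeffX (inj_eq (@mon_inj n d)) eq_sym (negbTE ne) mulr0.
- rewrite nm; apply: big1 => e _; rewrite mcoeffX.
  by case: eqP => [<-|_]; rewrite ?nm ?mul0r ?mulr0.
Qed.

Lemma pairing_linear c p q : pairing (c *: p + q) = c * pairing p + pairing q.
Proof.
rewrite mulr_sumr -big_split; apply: eq_bigr => e _ /=.
by rewrite mcoeffD mcoeffZ mulrDr mulrCA.
Qed.

Lemma pairing0 : pairing 0 = 0.
Proof. by apply: big1 => e _; rewrite mcoeff0 mulr0. Qed.

Lemma pairing_sum (I : Type) (r : seq I) (c : I -> K) (p : I -> {mpoly K[n]}) :
  pairing (\sum_(i <- r) c i *: p i) = \sum_(i <- r) c i * pairing (p i).
Proof.
elim: r => [|i r IH]; first by rewrite !big_nil pairing0.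
by rewrite !big_cons pairing_linear IH.
Qed.

Lemma pairing_lX m : pairing (l * 'X_[m]) = 0.
Proof.
rewrite form1_mulX // pairing_sum -[RHS](F_contract m).
by apply: eq_bigr => v _; rewrite pairingX.
Qed.

Lemma pairing_l f : pairing (l * f) = 0.
Proof.
rewrite [f]mpolyE mulr_sumr.
rewrite (eq_bigr (fun m => f@_m *: (l * 'X_[m]))) => [|m _]; last by rewrite scalerAr.
by rewrite pairing_sum big1 // => m _; rewrite pairing_lX mulr0.
Qed.

Lemma pairing_J p : J p -> pairing p = 0.
Proof.
move=> /(in_idealP d.+2 complexD) Jp; apply: big1 => e _.
case: (eqVneq (F (mon e)) 0) => [->|/F_supp[_]]; first by rewrite mul0r.
by rewrite mvars_mon -standard_mon => /Jp->; rewrite mulr0.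
Qed.

(** The pairing kills both [l * f] and [J], but not ['X_[m]]. *)
Lemma l_not_surjective m : F m != 0 -> ~ (exists f, J ('X_[m] - l * f)).
Proof.
move=> Fm [f /pairing_J]; rewrite -scaleN1r addrC pairing_linear pairing_l.
by rewrite mulr0 add0r pairingX => /eqP; apply/negP.
Qed.

(** [M] is the matrix of multiplication by [l] in monomial bases, acting on row vectors. The values
    of [F] form a nonzero column killed by [M], so its rank is below [#|B| <= #|A|], and a nonzero
    row [u] in the left kernel gives the form [f]. *)
Lemma l_not_injective m : F m != 0 ->
  (#|expos d Delta (mdeg m)| <= #|expos d Delta (mdeg m).-1|)%N ->
  ~ (forall f, is_form (mdeg m).-1 f -> J (l * f) -> J f).
Proof.
set N := mdeg m => Fm leBA inj.
have [fm _] := F_supp Fm.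
have N2 := full_mdeg fm; rewrite -/N in N2.
have N_gt0 : (0 < N)%N by lia.
pose A := expos d Delta N.-1; pose B := expos d Delta N.
pose M : 'M[K]_(#|A|, #|B|) :=
  \matrix_(i, j) (l * 'X_[mon (enum_val i)])@_(mon (enum_val j)).
pose c : 'cV[K]_#|B| := \col_j F (mon (enum_val j)).
have F_B e : F (mon e) != 0 -> e \in B.
  move=> /F_supp[fe]; rewrite mvars_mon inE => ->; rewrite -mdeg_mon.
  by apply/eqP; have := full_mdeg fe; lia.
have Mc : M *m c = 0.
  apply/matrixP => i j; rewrite !mxE -[RHS](pairing_lX (mon (enum_val i))) /pairing.
  rewrite [RHS](bigID (mem B)) /= [X in _ = _ + X]big1 ?addr0 => [|e]; last first.
    by move=> /(contraNeq (@F_B e))->; rewrite mul0r.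
  rewrite (big_enum_val (fun e => F (mon e) * (l * 'X_[mon (enum_val i)])@_(mon e))).
  by apply: eq_bigr => k _; rewrite !mxE mulrC.
have c_neq0 : c != 0.
  have [e me] := monP (fun v => full_le v fm).
  have eB : e \in B by apply: F_B; rewrite -me.
  apply/eqP => /matrixP/(_ (enum_rank_in eB e) 0); rewrite !mxE enum_rankK_in // -me.
  by apply/eqP.
have [u uM u_neq0] : exists2 u : 'rV_#|A|, u *m M = 0 & u != 0.
  case: (boolP (row_free M)) => [frM|].
    have /row_fullP[M' M'M] : row_full M.
      by rewrite /row_full eqn_leq rank_leq_col (eqP frM).
    by move: c_neq0; rewrite -[c]mul1mx -M'M -mulmxA Mc mulmx0 eqxx.
  rewrite -kermx_eq0 => /rowV0Pn[u /sub_kermxP uM nu]; by exists u.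
pose f := \sum_i u 0 i *: 'X_[K, mon (enum_val i)].
have lfE : l * f = \sum_i u 0 i *: (l * 'X_[mon (enum_val i)]).
  by rewrite mulr_sumr; apply: eq_bigr => i _; rewrite scalerAr.
have A_deg (i : 'I_#|A|) : mdeg (mon (enum_val i)) = N.-1.
  by have := enum_valP i; rewrite inE mdeg_mon => /andP[_ /eqP].
have f_form : is_form N.-1 f.
  by rewrite /is_form rpred_sum // => i _; rewrite rpredZ // dhomogX /= A_deg.
have Jlf : J (l * f).
  apply/(in_idealP d.+2 complexD) => k k_std; rewrite lfE raddf_sum /=.
  (* Coefficients in degrees other than [N] vanish by homogeneity; those in degree [N] are the
     entries of [u *m M]. *)
  case: (eqVneq (mdeg k) N) => [kN|kN]; last first.
    apply: big1 => i _; rewrite mcoeffZ form1_mulX // raddf_sum /= big1 ?mulr0 // => v _.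
    rewrite mcoeffZ mcoeffX; case: (_ =P k) kN => [<-|_ _]; last by rewrite mulr0.
    by move=> /eqP[]; rewrite mdegD mdeg1 A_deg addn1 prednK.
  have [e ke] : exists e, k = mon (d := d) e.
    by apply: monP => v; case/andP: k_std => /forallP /(_ v).
  have eB : e \in B by rewrite inE -mdeg_mon -ke kN eqxx -standard_mon -ke k_std.
  have /matrixP/(_ 0 (enum_rank_in eB e)) := uM; rewrite !mxE => uMe.
  rewrite -[RHS]uMe.
  by apply: eq_bigr => i _; rewrite mcoeffZ !mxE enum_rankK_in // -ke.
have /(in_idealP d.+2 complexD) Jf := inj f f_form Jlf.
case/eqP: u_neq0; apply/rowP => i; rewrite mxE.
have iD : standard d.+2 Delta (mon (enum_val i)).
  by rewrite standard_mon; have := enum_valP i; rewrite inE => /andP[].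
rewrite -[RHS](Jf _ iD) raddf_sum /= (bigD1 i) //= mcoeffZ mcoeffX eqxx mulr1.
rewrite big1 ?addr0 // => j ji; rewrite mcoeffZ mcoeffX (inj_eq (@mon_inj n d)).
by rewrite (inj_eq enum_val_inj) (negbTE ji) mulr0.
Qed.

End Functional.

Theorem theorem6p7 (K : fieldType) (n : nat) (Delta : {set {set 'I_n}}) (d : nat) :
  is_simplicial_complex Delta -> has_vertex_set Delta ->
  sc_dim Delta d -> (0 < d)%N ->
  (fvec Delta d.-1 >= fvec Delta d)%N ->
  red_homology_nonzero K Delta d ->
  ~ WLP (in_ideal (@J_gen K n Delta d.+2)).
Proof.
move=> complexD _ dimD d_gt0 fD [z [z_chain z_cycle z_nb]] [l l_form wlp].
(* The zero chain is a boundary, so [z] is nonzero. *)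
have [s0 zs0] : exists s, z s != 0.
  apply/existsP; apply: contra_notT z_nb => /existsPn z0; exists 0; split.
    by move=> s; rewrite ffunE eqxx.
  apply/ffunP => s; have /negbNE/eqP-> := z0 s; rewrite ffunE big1 // => v _.
  by rewrite ffunE mulr0.
have [F [F_supp F_contract [m Fm]]] :=
  exists_dual (fun v => l@_U_(v)) z_chain z_cycle zs0.
have [fm _] := F_supp m Fm; have N2 := full_mdeg fm.
(* Twice [mdeg m] is [d.+1 * d.+2], so degree [(mdeg m).-1] is in the range of the Lefschetz
   property. *)
have lt_top : ((mdeg m).-1 < d.+1 * d.+1)%N by nia.
case: (wlp _ (top_degree_J K complexD dimD) _ lt_top) => [inj|surj].
  apply: (l_not_injective complexD l_form F_supp F_contract Fm _ inj).
  exact: leq_card_expos d_gt0 dimD.2 fD N2.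
have [|f _ Jf] := surj 'X_[m]; first by rewrite /is_form dhomogX /=; lia.
by apply: (l_not_surjective complexD l_form F_supp F_contract Fm); exists f.
Qed.
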